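(* Let $N\ge1$ be an integer and $\chi$ a Dirichlet character of conductor $f$. For $n\ge 1$, \[ B_{N,n,\chi}=\sum_{k=0}^n\frac{k!}{f^{N-k}}\binom{n}{k}\sum_{r=0}^k\binom{k+1}{r+1}\widetilde{T}_r(k)\, S_{n-k}, \qquad B_{N,n,\chi}(x)=\sum_{k=0}^n\frac{k!}{f^{N-k}}\binom{n}{k}\sum_{r=0}^k\binom{k+1}{r+1}\widetilde{T}_r(k)\, S_{n-k}(x), \] where \[ \widetilde{T}_r(k):=(-N!)^r\sum_{\substack{i_1+\cdots+i_r=k\\ i_1,\dots,i_r\ge 0}}\frac{1}{(N+i_1)!\cdots(N+i_r)!} \] with $\widetilde{T}_0(0)=1$ and $\widetilde{T}_0(k)=0$ for $k\ge 1$.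
   Context: For an integer $N\ge 1$ and a Dirichlet character $\chi$ of conductor $f$, the generalized hypergeometric Bernoulli numbers $B_{N,n,\chi}$ and polynomials $B_{N,n,\chi}(x)$ are defined by $\sum_{a=1}^f \frac{\chi(a)\, t^N e^{at}/N!}{e^{ft}-\sum_{m=0}^{N-1}\frac{(ft)^m}{m!}}=\sum_{n=0}^\infty B_{N,n,\chi}\frac{t^n}{n!}$ and $\sum_{a=1}^f \frac{\chi(a)\, t^N e^{(x+a)t}/N!}{e^{ft}-\sum_{m=0}^{N-1}\frac{(ft)^m}{m!}}=\sum_{n=0}^\infty B_{N,n,\chi}(x)\frac{t^n}{n!}$ for $|t|<2\pi/f$. Put $S_n:=\sum_{a=1}^f\chi(a)a^n$ and $S_n(x):=\sum_{a=1}^f\chi(a)(x+a)^n$. *)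

(* Defs.v *)
From Stdlib Require Export Reals ZArith List FinFun Lia.
From Coquelicot Require Export Coquelicot.

(* From here on [C] is the type of complex numbers; Stdlib's binomial
   coefficient is written [Binomial.C]. *)
Open Scope R_scope.

Record dirichlet_character (m : nat) (chi : Z -> C) : Prop := {
  dirichlet_modulus_pos : (0 < m)%nat;
  dirichlet_periodic : forall a : Z, chi (a + Z.of_nat m)%Z = chi a;
  dirichlet_mult : forall a b : Z, chi (a * b)%Z = Cmult (chi a) (chi b);
  dirichlet_support :
    forall a : Z, chi a <> RtoC 0 <-> Z.gcd a (Z.of_nat m) = 1%Z
}.

(* [d] is an induced modulus of the character [chi] mod [m]: [chi] is trivial
   on the units mod [m] that are congruent to 1 mod [d], i.e. [chi] factors
   through the units mod [d]. *)
Definition induced_modulus (m : nat) (chi : Z -> C) (d : nat) : Prop :=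
  Nat.divide d m /\
  forall a : Z, Z.gcd a (Z.of_nat m) = 1%Z ->
    Z.divide (Z.of_nat d) (a - 1) -> chi a = RtoC 1.

(* [chi] is primitive mod [f] exactly when [has_conductor f chi f]. *)
Definition has_conductor (m : nat) (chi : Z -> C) (f : nat) : Prop :=
  induced_modulus m chi f /\
  forall d : nat, induced_modulus m chi d -> (f <= d)%nat.

Definition Cexp (z : C) : C :=
  (exp (Re z) * cos (Im z), exp (Re z) * sin (Im z)).

(* e^(f t) - sum_(m < N) (f t)^m / m!, for N >= 1 ([sum_n u n] has n + 1 terms) *)
Definition exp_tail (N f : nat) (t : C) : C :=
  (Cexp (INR f * t)
   - sum_n (fun m : nat => (INR f * t) ^ m / INR (fact m)) (N - 1))%C.

Definition gen_fun (N f : nat) (chi : Z -> C) (t : C) : C :=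
  sum_n_m (fun a : nat =>
    (chi (Z.of_nat a) * t ^ N * Cexp (INR a * t) / INR (fact N))
    / exp_tail N f t)%C 1 f.

Definition gen_fun_poly (N f : nat) (chi : Z -> C) (x t : C) : C :=
  sum_n_m (fun a : nat =>
    (chi (Z.of_nat a) * t ^ N * Cexp ((x + INR a) * t) / INR (fact N))
    / exp_tail N f t)%C 1 f.

(* The defining identity of the numbers B_(N,n,chi), n >= 0.  The generating
   function is 0/0 at t = 0, a removable singularity, hence [t <> 0]; the
   identity on the punctured disc determines the sequence [B]. *)
Definition hyp_bernoulli_numbers
    (N f : nat) (chi : Z -> C) (B : nat -> C) : Prop :=
  forall t : C, t <> RtoC 0 -> Cmod t < 2 * PI / INR f ->
    is_series (fun n : nat => B n * (t ^ n / INR (fact n)))%C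
              (gen_fun N f chi t).

(* The defining identity of the polynomials B_(N,n,chi)(x) = [B n x]. *)
Definition hyp_bernoulli_polys
    (N f : nat) (chi : Z -> C) (B : nat -> C -> C) : Prop :=
  forall x t : C, t <> RtoC 0 -> Cmod t < 2 * PI / INR f ->
    is_series (fun n : nat => B n x * (t ^ n / INR (fact n)))%C
              (gen_fun_poly N f chi x t).

Definition S_chi (f : nat) (chi : Z -> C) (n : nat) : C :=
  sum_n_m (fun a : nat => chi (Z.of_nat a) * INR a ^ n)%C 1 f.

Definition S_chi_poly (f : nat) (chi : Z -> C) (n : nat) (x : C) : C :=
  sum_n_m (fun a : nat => chi (Z.of_nat a) * (x + INR a) ^ n)%C 1 f.

(* All tuples (i_1, ..., i_r) of natural numbers with sum k, each listed once;
   see [in_compositions] and [NoDup_compositions]. *)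
Fixpoint compositions (r k : nat) : list (list nat) :=
  match r with
  | O => match k with O => nil :: nil | S _ => nil end
  | S r' =>
      flat_map (fun i : nat => map (cons i) (compositions r' (k - i)))
               (seq 0 (S k))
  end.

Lemma in_compositions (r k : nat) (l : list nat) :
  In l (compositions r k) <-> length l = r /\ list_sum l = k.
Proof.
revert k l; induction r as [|r IH]; intros k l; simpl compositions.
- destruct k as [|k]; simpl.
  + split.
    * intros [<-|[]]; auto.
    * intros [Hl _]; apply length_zero_iff_nil in Hl; auto.
  + split; [tauto|].
    intros [Hl Hs]; apply length_zero_iff_nil in Hl; subst l; discriminate Hs.
- change (In l (flat_map (fun i : nat => map (cons i) (compositions r (k - i)))
                         (seq 0 (S k))) <-> length l = S r /\ list_sum l = k).
  rewrite in_flat_map; split.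
  + intros [i [Hi Hl]]; apply in_seq in Hi; apply in_map_iff in Hl.
    destruct Hl as [l' [<- Hl']]; apply IH in Hl'; simpl; lia.
  + destruct l as [|i l']; intros [Hl Hs]; [discriminate|].
    simpl in Hl, Hs.
    exists i; split; [apply in_seq; lia|].
    apply in_map, IH; lia.
Qed.

Lemma NoDup_compositions (r k : nat) : NoDup (compositions r k).
Proof.
revert k; induction r as [|r IH]; intros k.
- destruct k; simpl; repeat constructor; simpl; tauto.
- change (NoDup (flat_map (fun i : nat => map (cons i) (compositions r (k - i)))
                          (seq 0 (S k)))).
  generalize (seq_NoDup (S k) 0); induction (seq 0 (S k)) as [|i s IHs];
    simpl; intros Hs; [constructor|].
  inversion_clear Hs as [|? ? Hi Hs'].
  apply NoDup_app.
  + apply Injective_map_NoDup; [intros x y E; congruence|apply IH].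
  + exact (IHs Hs').
  + intros l Hl Hl'; apply in_map_iff in Hl; destruct Hl as [l1 [<- _]].
    apply in_flat_map in Hl'; destruct Hl' as [j [Hj Hl']].
    apply in_map_iff in Hl'; destruct Hl' as [l2 [E _]].
    injection E; intros _ <-; exact (Hi Hj).
Qed.

(* T~_r(k); the conventions T~_0(0) = 1 and T~_0(k) = 0 for k >= 1 come out of
   the empty tuple, see [T_tilde_0_0] and [T_tilde_0_S]. *)
Definition T_tilde (N r k : nat) : R :=
  (- INR (fact N)) ^ r
  * fold_right Rplus 0
      (map (fun l : list nat =>
              / fold_right Rmult 1 (map (fun i : nat => INR (fact (N + i))) l))
           (compositions r k)).

Lemma T_tilde_0_0 (N : nat) : T_tilde N 0 0 = 1.
Proof. unfold T_tilde; simpl; field. Qed.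

Lemma T_tilde_0_S (N k : nat) : T_tilde N 0 (S k) = 0.
Proof. unfold T_tilde; simpl; ring. Qed.

(* k! / f^(N-k) * binom(n, k) * sum_(r = 0)^k binom(k+1, r+1) T~_r(k); the
   exponent N - k is an integer, negative when k > N. *)
Definition explicit_coef (N f n k : nat) : R :=
  INR (fact k) / powerRZ (INR f) (Z.of_nat N - Z.of_nat k)
  * Binomial.C n k
  * sum_n (fun r : nat => Binomial.C (k + 1) (r + 1) * T_tilde N r k) k.

(* Main.v *)
(* Write [g(u) = sum_i N!/(N+i)! u^i].  The denominator of the generating
   function is [(f t)^N g(f t) / N!], so the defining identity reads
   [f^N g(f t) (sum_n B_n t^n/n!) = sum_a chi(a) e^((x+a) t)].  Comparing
   coefficients gives a convolution equation for [B_n/n!], which is solved by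
   convolving with the coefficients of
   [1/g = sum_j (1-g)^j = sum_j sum_r binom(j,r) (-g)^r].  Coefficients are
   already determined by real [t] near 0, so everything is done with pairs of
   real power series; a factor [t] is put on both sides to make the identity
   hold at [t = 0] too. *)

Require Import Defs.
From Stdlib Require Import Lra.

Local Open Scope C_scope.

(** * Convolution of coefficient sequences *)

Definition conv (a b : nat -> C) (n : nat) : C :=
  sum_n (fun k => a k * b (n - k)%nat) n.

Lemma sum_n_ext_C (a b : nat -> C) n :
  (forall k, (k <= n)%nat -> a k = b k) -> sum_n a n = sum_n b n.
Proof. intros H; apply sum_n_ext_loc; exact H. Qed.

Lemma sum_n_plus_C (a b : nat -> C) n :
  sum_n (fun k => a k + b k) n = sum_n a n + sum_n b n.
Proof. exact (sum_n_plus a b n). Qed.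

Lemma sum_n_scal_C (c : C) (a : nat -> C) n :
  sum_n (fun k => c * a k) n = c * sum_n a n.
Proof. exact (sum_n_mult_l c a n). Qed.

Lemma sum_n_last_C (a : nat -> C) n : sum_n a (S n) = sum_n a n + a (S n).
Proof. exact (sum_Sn a n). Qed.

Lemma sum_n_head_C (a : nat -> C) n :
  sum_n a (S n) = a O + sum_n (fun k => a (S k)) n.
Proof.
unfold sum_n; rewrite sum_Sn_m by lia; rewrite <- sum_n_m_S; reflexivity.
Qed.

Lemma conv_ext (a a' b b' : nat -> C) n :
  (forall k, (k <= n)%nat -> a k = a' k) ->
  (forall k, (k <= n)%nat -> b k = b' k) -> conv a b n = conv a' b' n.
Proof.
intros Ha Hb; apply sum_n_ext_C; intros k Hk.
rewrite Ha, Hb by lia; reflexivity.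
Qed.

Lemma conv_head (a b : nat -> C) n :
  conv a b (S n) = a O * b (S n) + conv (fun k => a (S k)) b n.
Proof. unfold conv; rewrite sum_n_head_C; reflexivity. Qed.

Lemma conv_last (a b : nat -> C) n :
  conv a b (S n) = conv a (fun k => b (S k)) n + a (S n) * b O.
Proof.
unfold conv; rewrite sum_n_last_C, Nat.sub_diag; f_equal.
apply sum_n_ext_C; intros k Hk; do 2 f_equal; lia.
Qed.

Lemma conv_comm (a b : nat -> C) n : conv a b n = conv b a n.
Proof.
revert a b; induction n as [|n IH]; intros a b.
- unfold conv; rewrite !sum_O; apply Cmult_comm.
- rewrite conv_head, conv_last, IH; ring.
Qed.

Lemma conv_plus_l (a a' b : nat -> C) n :
  conv (fun k => a k + a' k) b n = conv a b n + conv a' b n.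
Proof.
unfold conv; rewrite <- sum_n_plus_C; apply sum_n_ext_C; intros; ring.
Qed.

Lemma conv_scal_l (c : C) (a b : nat -> C) n :
  conv (fun k => c * a k) b n = c * conv a b n.
Proof.
unfold conv; rewrite <- sum_n_scal_C; apply sum_n_ext_C; intros; ring.
Qed.

(** Induction on the degree with [a] generalised: splitting off [a O] leaves a scalar multiple of
    [conv b c] and a convolution with the shifted [a], one degree lower. *)
Lemma conv_assoc (a b c : nat -> C) n :
  conv (conv a b) c n = conv a (conv b c) n.
Proof.
revert a; induction n as [|n IH]; intros a.
- unfold conv; rewrite !sum_O; symmetry; apply Cmult_assoc.
- rewrite (conv_head a), <- IH, conv_head.
  rewrite (conv_ext (fun k => conv a b (S k))
    (fun k => a O * b (S k) + conv (fun k => a (S k)) b k) c c)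
    by (intros; try apply conv_head; reflexivity).
  rewrite conv_plus_l, conv_scal_l, conv_head.
  unfold conv at 1; rewrite sum_O; simpl; ring.
Qed.

Lemma conv_plus_r (a b b' : nat -> C) n :
  conv a (fun k => b k + b' k) n = conv a b n + conv a b' n.
Proof. rewrite !(conv_comm a); apply conv_plus_l. Qed.

Lemma conv_scal_r (c : C) (a b : nat -> C) n :
  conv a (fun k => c * b k) n = c * conv a b n.
Proof. rewrite !(conv_comm a); apply conv_scal_l. Qed.

Lemma conv_sum_r (a : nat -> C) (b : nat -> nat -> C) M n :
  conv a (fun k => sum_n (fun r => b r k) M) n =
  sum_n (fun r => conv a (b r) n) M.
Proof.
induction M as [|M IH].
- rewrite sum_O; apply conv_ext; intros; rewrite ?sum_O; reflexivity.
- rewrite sum_n_last_C, <- IH, <- conv_plus_r.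
  apply conv_ext; intros; rewrite ?sum_n_last_C; reflexivity.
Qed.

Definition conv_one (n : nat) : C := match n with O => 1 | S _ => 0 end.

Lemma conv_one_l (a : nat -> C) n : conv conv_one a n = a n.
Proof.
destruct n as [|n].
- unfold conv; rewrite sum_O; simpl; ring.
- rewrite conv_head; simpl.
  rewrite (conv_ext _ (fun k => 0 * a k) a a) by (intros; simpl; ring).
  rewrite conv_scal_l; ring.
Qed.

(* Unlike [Binomial.C], this vanishes for [n < p]. *)
Definition binom (n p : nat) : R :=
  if (p <=? n)%nat then Binomial.C n p else 0%R.

Lemma binom_eq n p : (p <= n)%nat -> binom n p = Binomial.C n p.
Proof. intros H; unfold binom; rewrite (proj2 (Nat.leb_le _ _) H); auto. Qed.

Lemma binom_gt n p : (n < p)%nat -> binom n p = 0%R.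
Proof. intros H; unfold binom; rewrite (proj2 (Nat.leb_gt _ _) H); auto. Qed.

Lemma binom_0 n : binom n 0 = 1%R.
Proof.
rewrite binom_eq by lia; unfold Binomial.C; rewrite Nat.sub_0_r; simpl.
field; apply INR_fact_neq_0.
Qed.

Lemma binom_diag n : binom n n = 1%R.
Proof.
rewrite binom_eq by lia; unfold Binomial.C; rewrite Nat.sub_diag; simpl.
field; apply INR_fact_neq_0.
Qed.

Lemma binom_pascal n p : binom (S n) (S p) = (binom n p + binom n (S p))%R.
Proof.
destruct (Nat.lt_trichotomy p n) as [H|[<-|H]].
- rewrite !binom_eq by lia; symmetry; apply pascal; auto.
- rewrite !binom_diag, binom_gt by lia; ring.
- rewrite !binom_gt by lia; ring.
Qed.

(** * Reciprocal of a power series with constant term 1 *)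

Section Reciprocal.

Variables (g : nat -> C) (T : nat -> nat -> C).
Hypothesis g0 : g O = 1.
Hypothesis T0 : forall k, T O k = conv_one k.
(* [T r] is the coefficient sequence of [(-g)^r] *)
Hypothesis TS : forall r k, T (S r) k = - conv g (T r) k.

(** Coefficient of degree [k] in [(1-g)^j], by the binomial theorem. Since [binom j r] vanishes for
    [r > j], all bounds [M >= j] give the same value, so one [M] can serve several powers at
    once. *)
Let one_minus_pow (M j k : nat) : C := sum_n (fun r => binom j r * T r k) M.

(** Coefficient of degree [k] in the sum of [(1-g)^j] over [j < K], when [M] is large enough; the
    hockey-stick identity has already collapsed the sum of [binom j r] over [j]. *)
Let partial (M K k : nat) : C := sum_n (fun r => binom K (S r) * T r k) M.

Lemma one_minus_pow_0 M k : one_minus_pow M 0 k = conv_one k.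
Proof.
unfold one_minus_pow; destruct M as [|M].
- rewrite sum_O, binom_0, T0; ring.
- rewrite sum_n_head_C, binom_0, T0.
  rewrite (sum_n_ext_C _ (fun r => 0 * T (S r) k)), sum_n_scal_C; [ring|].
  intros; rewrite binom_gt by lia; ring.
Qed.

(** By [TS], convolving with [g] turns [T r] into [-T (S r)]; Pascal's rule then recombines the two
    sums. *)
Lemma one_minus_pow_S M j k : (S j <= M)%nat ->
  one_minus_pow M (S j) k =
  one_minus_pow M j k - conv g (one_minus_pow M j) k.
Proof.
intros HM; unfold one_minus_pow; rewrite conv_sum_r.
destruct M as [|M]; [lia|].
rewrite (sum_n_head_C (fun r => binom (S j) r * T r k)).
rewrite (sum_n_head_C (fun r => binom j r * T r k)).
(* Raising [r] by one would push the top term out of range; its coefficient [binom j (S M)] is 0 by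
   the bound on [j]. *)
rewrite (sum_n_last_C (fun r => conv _ _ _)).
rewrite conv_scal_r, (binom_gt j (S M)), !binom_0 by lia.
replace (sum_n (fun r => conv g (fun k => binom j r * T r k) k) M)
  with (- sum_n (fun r => binom j r * T (S r) k) M).
- rewrite (sum_n_ext_C _
    (fun r => binom j r * T (S r) k + binom j (S r) * T (S r) k)).
  + rewrite sum_n_plus_C; ring.
  + intros; rewrite binom_pascal, RtoC_plus; ring.
- replace (- sum_n (fun r => binom j r * T (S r) k) M)
    with (- (1) * sum_n (fun r => binom j r * T (S r) k) M) by ring.
  rewrite <- sum_n_scal_C; apply sum_n_ext_C; intros r _.
  rewrite conv_scal_r, TS; ring.
Qed.

Lemma partial_S M K k :
  partial M (S K) k = partial M K k + one_minus_pow M K k.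
Proof.
unfold partial, one_minus_pow; rewrite <- sum_n_plus_C.
apply sum_n_ext_C; intros; rewrite binom_pascal, RtoC_plus; ring.
Qed.

(** Telescoping of the geometric sum: [g] times [(1-g)^j] is [(1-g)^j - (1-g)^(j+1)]. *)
Lemma conv_partial M K n : (K <= M)%nat ->
  conv g (partial M K) n = conv_one n - one_minus_pow M K n.
Proof.
induction K as [|K IH]; intros HK.
- rewrite one_minus_pow_0; unfold partial; rewrite conv_sum_r.
  rewrite (sum_n_ext_C _ (fun r => 0 * conv g (T r) n)), sum_n_scal_C; [ring|].
  intros; rewrite conv_scal_r, binom_gt by lia; reflexivity.
- rewrite one_minus_pow_S by lia.
  rewrite (conv_ext g g _ (fun k => partial M K k + one_minus_pow M K k))
    by (intros; try apply partial_S; reflexivity).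
  rewrite conv_plus_r, IH by lia; ring.
Qed.

(** By [g0] the series [1-g] has no constant term, so each factor raises the order by at least
    one. *)
Lemma one_minus_pow_lt M K k : (K <= M)%nat -> (k < K)%nat ->
  one_minus_pow M K k = 0.
Proof.
revert k; induction K as [|K IH]; intros k HM Hk; [lia|].
rewrite one_minus_pow_S by lia.
destruct k as [|k].
- unfold conv; rewrite sum_O, g0; simpl; ring.
- rewrite conv_head, g0.
  (* The head term cancels against the minuend. What remains meets [one_minus_pow M K] only in
     degrees up to [k], where it vanishes by induction. *)
  rewrite (conv_comm (fun k => g (S k))).
  rewrite (conv_ext _ (fun k => 0 * g k) _ (fun k => g (S k)));
    [rewrite conv_scal_l; ring| |auto].
  intros i Hi; rewrite IH by lia; ring.
Qed.

(** The powers [(1-g)^j] with [j > k] contribute nothing in degree [k]. *)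
Lemma partial_stable M K k : (k < K)%nat -> (K <= M)%nat ->
  partial M K k = partial M (S k) k.
Proof.
induction K as [|K IH]; intros Hk HM; [lia|].
destruct (Nat.eq_dec k K) as [->|]; [auto|].
rewrite partial_S, one_minus_pow_lt, IH by lia; ring.
Qed.

(** The terms with [r > k] carry [binom (S k) (S r) = 0]. *)
Lemma partial_bound M k : (k <= M)%nat -> partial M (S k) k = partial k (S k) k.
Proof.
induction M as [|M IH]; intros Hk.
- replace k with O by lia; auto.
- destruct (Nat.eq_dec k (S M)) as [->|]; [auto|].
  rewrite <- IH by lia; unfold partial.
  rewrite sum_n_last_C, (binom_gt (S k)) by lia; ring.
Qed.

(* From [1/g = sum_j (1-g)^j], where [(1-g)^j] starts at degree [j]: truncating
   at [j <= k] does not affect degree [k], and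
   [sum_(j <= k) binom(j, r) = binom(k+1, r+1)]. *)
Lemma conv_reciprocal n :
  conv g (fun k => sum_n (fun r => Binomial.C (k + 1) (r + 1) * T r k) k) n
  = conv_one n.
Proof.
rewrite (conv_ext g g _ (partial (S n) (S n))); auto.
- rewrite conv_partial, one_minus_pow_lt by lia; ring.
- intros k Hk; rewrite partial_stable, partial_bound by lia.
  apply sum_n_ext_C; intros r Hr.
  rewrite !Nat.add_1_r, binom_eq by lia; reflexivity.
Qed.

End Reciprocal.

(** * The numbers [T_tilde] as coefficients of the powers of [-g] *)

Lemma fold_right_Rplus_app (l l' : list R) :
  fold_right Rplus 0%R (l ++ l') =
  (fold_right Rplus 0 l + fold_right Rplus 0 l')%R.
Proof. induction l as [|x l IH]; simpl; [ring|rewrite IH; ring]. Qed.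

Lemma fold_right_Rplus_flat_map (u : nat -> list (list nat))
    (w : list nat -> R) k :
  fold_right Rplus 0%R (map w (flat_map u (seq 0 (S k)))) =
  sum_n (fun i => fold_right Rplus 0%R (map w (u i))) k.
Proof.
induction k as [|k IH].
- rewrite sum_O; simpl; rewrite app_nil_r; reflexivity.
- rewrite seq_S, flat_map_app, map_app, fold_right_Rplus_app, IH, sum_Sn.
  simpl; rewrite app_nil_r; reflexivity.
Qed.

(** The coefficients of the series [g]. *)
Definition tail_coef (N i : nat) : C := RtoC (INR (fact N) / INR (fact (N + i))).

Lemma RtoC_sum_n (a : nat -> R) n :
  RtoC (sum_n a n) = sum_n (fun k => RtoC (a k)) n.
Proof.
induction n as [|n IH].
- rewrite !sum_O; reflexivity.
- rewrite sum_n_last_C, <- IH, sum_Sn, <- RtoC_plus; reflexivity.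
Qed.

Definition composition_sum (N r k : nat) : R :=
  fold_right Rplus 0%R
    (map (fun l : list nat =>
            (/ fold_right Rmult 1 (map (fun i : nat => INR (fact (N + i))) l))%R)
         (compositions r k)).

(** Sorting the tuples by their first entry [i] makes the sum a convolution. *)
Lemma composition_sum_S N r k :
  composition_sum N (S r) k =
  sum_n (fun i => (/ INR (fact (N + i)) * composition_sum N r (k - i))%R) k.
Proof.
unfold composition_sum at 1; change (compositions (S r) k) with
  (flat_map (fun i : nat => map (cons i) (compositions r (k - i)))
               (seq 0 (S k))).
rewrite fold_right_Rplus_flat_map; apply sum_n_ext; intros i.
rewrite map_map; unfold composition_sum.
induction (compositions r (k - i)) as [|a l IH]; simpl in *; [ring|].
rewrite IH, Rinv_mult; ring.
Qed.

(** The extra factor [-N!] joins the [1/(N+i)!] of the first entry to form a coefficient of [-g].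
    This supplies the hypothesis [TS]. *)
Lemma T_tilde_S N r k :
  RtoC (T_tilde N (S r) k) =
  - conv (tail_coef N) (fun j => RtoC (T_tilde N r j)) k.
Proof.
change (T_tilde N (S r) k)
  with ((- INR (fact N)) ^ S r * composition_sum N (S r) k)%R.
rewrite composition_sum_S, RtoC_mult, RtoC_sum_n, <- sum_n_scal_C.
replace (- conv (tail_coef N) (fun j => RtoC (T_tilde N r j)) k) with
  (- (1) * conv (tail_coef N) (fun j => RtoC (T_tilde N r j)) k) by ring.
unfold conv; rewrite <- sum_n_scal_C; apply sum_n_ext_C; intros i _.
unfold tail_coef.
change (T_tilde N r (k - i))
  with ((- INR (fact N)) ^ r * composition_sum N r (k - i))%R.
rewrite <- !RtoC_mult, <- RtoC_opp, <- RtoC_mult; f_equal; simpl.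
unfold Rdiv; ring.
Qed.

(** * Expansions at 0 along the real line *)

Definition rgerm (a : nat -> R) (F : R -> R) : Prop :=
  locally 0%R (fun t : R => is_pseries a t (F t)).

(** Beyond the radius of convergence the terms would not tend to 0. *)
Lemma ex_pseries_radius (a : nat -> R) (x : R) :
  ex_pseries a x -> Rbar_le (Rabs x) (CV_radius a).
Proof.
intros Ha; apply Rbar_not_lt_le; intros H.
apply (CV_disk_outside _ _ H).
apply ex_series_lim_0; apply ex_series_ext with (2 := Ha).
intros n; rewrite pow_n_pow; apply Rmult_comm.
Qed.

(** Convergence at the single point [d / 2] puts all points closer to 0 strictly inside the disc of
    convergence, as multiplication of series requires. *)
Lemma rgerm_radius a F : rgerm a F ->
  locally 0%R (fun t : R => Rbar_lt (Rabs t) (CV_radius a)).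
Proof.
intros [d Hd].
assert (Hd2 : (0 < d / 2)%R) by (destruct d; simpl; lra).
exists (mkposreal _ Hd2); intros t Ht.
apply Rbar_lt_le_trans with (Rabs (d / 2)).
- rewrite (Rabs_pos_eq (d / 2)) by lra.
  change (Rabs (t - 0) < d / 2)%R in Ht; rewrite Rminus_0_r in Ht; exact Ht.
- apply ex_pseries_radius; exists (F (d / 2)%R); apply Hd.
  change (Rabs (d / 2 - 0) < d)%R; rewrite Rminus_0_r, Rabs_pos_eq by lra; lra.
Qed.

Lemma rgerm_radius_pos a F : rgerm a F -> Rbar_lt 0 (CV_radius a).
Proof.
intros H; apply rgerm_radius, locally_singleton in H.
rewrite Rabs_R0 in H; exact H.
Qed.

Lemma rgerm_ext a b F G :
  (forall n, a n = b n) -> locally 0%R (fun t => F t = G t) ->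
  rgerm a F -> rgerm b G.
Proof.
unfold rgerm; intros Hab HFG Ha; generalize (filter_and _ _ HFG Ha).
apply filter_imp; intros t [<- Ht].
apply is_series_ext with (2 := Ht); intros n; rewrite Hab; reflexivity.
Qed.

Lemma rgerm_plus a b F G : rgerm a F -> rgerm b G ->
  rgerm (fun n => a n + b n)%R (fun t => F t + G t)%R.
Proof.
unfold rgerm; intros Ha Hb; generalize (filter_and _ _ Ha Hb); apply filter_imp.
intros t [H1 H2]; exact (is_pseries_plus a b t _ _ H1 H2).
Qed.

Lemma rgerm_scal c a F : rgerm a F ->
  rgerm (fun n => c * a n)%R (fun t => c * F t)%R.
Proof.
unfold rgerm; apply filter_imp; intros t H.
refine (is_pseries_scal c a t _ _ H); apply Rmult_comm.
Qed.

Lemma rgerm_minus a b F G : rgerm a F -> rgerm b G ->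
  rgerm (fun n => a n - b n)%R (fun t => F t - G t)%R.
Proof.
intros Ha Hb; generalize (rgerm_plus _ _ _ _ Ha (rgerm_scal (-1) _ _ Hb)).
apply rgerm_ext; [intros; ring|].
apply filter_forall; intros; ring.
Qed.

Lemma rgerm_mult a b F G : rgerm a F -> rgerm b G ->
  rgerm (PS_mult a b) (fun t => F t * G t)%R.
Proof.
intros Ha Hb.
generalize (filter_and _ _ (filter_and _ _ Ha Hb)
  (filter_and _ _ (rgerm_radius _ _ Ha) (rgerm_radius _ _ Hb))).
unfold rgerm; apply filter_imp; intros t [[H1 H2] [H3 H4]]; apply is_pseries_mult; auto.
Qed.

Lemma rgerm_shift a F : rgerm a F ->
  rgerm (fun n => match n with O => 0 | S n => a n end)%R (fun t => t * F t)%R.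
Proof.
intros Ha; apply rgerm_ext with (PS_incr_1 a) (fun t => t * F t)%R.
- intros [|n]; reflexivity.
- apply filter_forall; reflexivity.
- revert Ha; unfold rgerm; apply filter_imp; intros t.
  exact (is_pseries_incr_1 a t (F t)).
Qed.

Lemma rgerm_unique a b F : rgerm a F -> rgerm b F -> forall n, a n = b n.
Proof.
intros Ha Hb n; apply PSeries_ext_recip.
- exact (rgerm_radius_pos _ _ Ha).
- exact (rgerm_radius_pos _ _ Hb).
- generalize (filter_and _ _ Ha Hb); apply filter_imp; intros t [H1 H2].
  rewrite (is_pseries_unique _ _ _ H1), (is_pseries_unique _ _ _ H2).
  reflexivity.
Qed.

(** Splitting into real and imaginary parts makes products and uniqueness of coefficients
    consequences of the real case. *)
Definition cgerm (a : nat -> C) (F : R -> C) : Prop :=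
  rgerm (fun n => Re (a n)) (fun t => Re (F t)) /\
  rgerm (fun n => Im (a n)) (fun t => Im (F t)).

Lemma cgerm_ext a b F G :
  (forall n, a n = b n) -> locally 0%R (fun t => F t = G t) ->
  cgerm a F -> cgerm b G.
Proof.
intros Hab HFG [H1 H2]; split; [revert H1|revert H2]; apply rgerm_ext;
  try (intros n; rewrite Hab; reflexivity);
  revert HFG; apply filter_imp; intros t ->; reflexivity.
Qed.

Lemma cgerm_plus a b F G : cgerm a F -> cgerm b G ->
  cgerm (fun n => a n + b n) (fun t => F t + G t).
Proof. intros [H1 H2] [H3 H4]; split; apply rgerm_plus; auto. Qed.

Lemma Re_sum_n (a : nat -> C) n : Re (sum_n a n) = sum_n (fun k => Re (a k)) n.
Proof.
induction n as [|n IH]; [rewrite !sum_O; auto|].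
rewrite !sum_Sn, <- IH; reflexivity.
Qed.

Lemma Im_sum_n (a : nat -> C) n : Im (sum_n a n) = sum_n (fun k => Im (a k)) n.
Proof.
induction n as [|n IH]; [rewrite !sum_O; auto|].
rewrite !sum_Sn, <- IH; reflexivity.
Qed.

Lemma sum_n_plus_R (a b : nat -> R) n :
  sum_n (fun k => a k + b k)%R n = (sum_n a n + sum_n b n)%R.
Proof. exact (sum_n_plus a b n). Qed.

Lemma Re_conv (a b : nat -> C) n : Re (conv a b n) =
  (PS_mult (fun k => Re (a k)) (fun k => Re (b k)) n -
   PS_mult (fun k => Im (a k)) (fun k => Im (b k)) n)%R.
Proof.
unfold conv, PS_mult; rewrite Re_sum_n, <- !sum_n_Reals.
transitivity (sum_n (fun k => Re (a k) * Re (b (n - k)%nat) +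
  (-1) * (Im (a k) * Im (b (n - k)%nat)))%R n).
{ apply sum_n_ext; intros k; rewrite re_mult.
  unfold Rminus; apply f_equal; change (- (Im (a k) * Im (b (n - k)%nat)) =
    -1 * (Im (a k) * Im (b (n - k)%nat)))%R; ring. }
rewrite sum_n_plus_R.
replace (sum_n (fun k => (-1) * (Im (a k) * Im (b (n - k)%nat)))%R n)
  with ((-1) * sum_n (fun k => (Im (a k) * Im (b (n - k)%nat)))%R n)%R.
- ring.
- symmetry; exact (sum_n_mult_l (K := R_Ring) (-1)%R _ n).
Qed.

Lemma Im_conv (a b : nat -> C) n : Im (conv a b n) =
  (PS_mult (fun k => Re (a k)) (fun k => Im (b k)) n +
   PS_mult (fun k => Im (a k)) (fun k => Re (b k)) n)%R.
Proof.
unfold conv, PS_mult; rewrite Im_sum_n, <- !sum_n_Reals, <- sum_n_plus_R.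
apply sum_n_ext; intros; apply im_mult.
Qed.

Lemma cgerm_mult a b F G : cgerm a F -> cgerm b G ->
  cgerm (conv a b) (fun t => F t * G t).
Proof.
intros [H1 H2] [H3 H4]; split.
- generalize (rgerm_minus _ _ _ _ (rgerm_mult _ _ _ _ H1 H3)
    (rgerm_mult _ _ _ _ H2 H4)).
  apply rgerm_ext; [intros; rewrite Re_conv; reflexivity|].
  apply filter_forall; reflexivity.
- generalize (rgerm_plus _ _ _ _ (rgerm_mult _ _ _ _ H1 H4)
    (rgerm_mult _ _ _ _ H2 H3)).
  apply rgerm_ext; [intros; rewrite Im_conv; reflexivity|].
  apply filter_forall; reflexivity.
Qed.

Lemma rgerm_0 : rgerm (fun _ => 0%R) (fun _ => 0%R).
Proof.
unfold rgerm; apply filter_forall; intros t; unfold is_pseries.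
apply is_series_ext with (fun _ => zero).
- intros n; symmetry; apply (scal_zero_r (V := R_ModuleSpace)).
- apply filterlim_ext with (fun _ => 0%R); [|apply filterlim_const].
  intros n; symmetry; exact (sum_n_m_const_zero (G := R_AbelianMonoid) 0 n).
Qed.

Lemma cgerm_real a F :
  rgerm a F -> cgerm (fun n => RtoC (a n)) (fun t => RtoC (F t)).
Proof. intros H; split; [exact H|exact rgerm_0]. Qed.

Lemma cgerm_scal c a F : cgerm a F ->
  cgerm (fun n => c * a n) (fun t => c * F t).
Proof.
intros [H1 H2]; split.
- exact (rgerm_minus _ _ _ _ (rgerm_scal (Re c) _ _ H1)
    (rgerm_scal (Im c) _ _ H2)).
- exact (rgerm_plus _ _ _ _ (rgerm_scal (Re c) _ _ H2)
    (rgerm_scal (Im c) _ _ H1)).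
Qed.

Lemma cgerm_shift a F : cgerm a F ->
  cgerm (fun n => match n with O => 0 | S n => a n end) (fun t => t * F t).
Proof.
intros [H1 H2]; split; [generalize (rgerm_shift _ _ H1)
  |generalize (rgerm_shift _ _ H2)]; apply rgerm_ext;
  try (intros [|n]; reflexivity);
  apply filter_forall; intros t; symmetry;
  first [apply re_scal_l|apply im_scal_l].
Qed.

Lemma cgerm_unique a b F : cgerm a F -> cgerm b F -> forall n, a n = b n.
Proof.
intros [H1 H2] [H3 H4] n; apply injective_projections.
- exact (rgerm_unique _ _ _ H1 H3 n).
- exact (rgerm_unique _ _ _ H2 H4 n).
Qed.

Lemma is_series_Re (a : nat -> C) (l : C) :
  is_series a l -> is_series (fun n => Re (a n)) (Re l).
Proof.
intros H; apply filterlim_ext with (fun n => Re (sum_n a n)).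
- intros n; apply Re_sum_n.
- refine (filterlim_comp _ _ _ _ _ _ _ _ H _).
  intros P [d Hd]; exists d; intros y [Hy _]; apply Hd; exact Hy.
Qed.

Lemma is_series_Im (a : nat -> C) (l : C) :
  is_series a l -> is_series (fun n => Im (a n)) (Im l).
Proof.
intros H; apply filterlim_ext with (fun n => Im (sum_n a n)).
- intros n; apply Im_sum_n.
- refine (filterlim_comp _ _ _ _ _ _ _ _ H _).
  intros P [d Hd]; exists d; intros y [_ Hy]; apply Hd; exact Hy.
Qed.

Lemma cgerm_intro (a : nat -> C) (F : R -> C) :
  locally 0%R (fun t : R => is_series (fun n => a n * RtoC t ^ n) (F t)) ->
  cgerm a F.
Proof.
intros H; split; revert H; unfold rgerm; apply filter_imp; intros t H.
- apply is_series_ext with (2 := is_series_Re _ _ H); intros n.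
  change (Re (a n * RtoC t ^ n) = (pow_n t n * Re (a n))%R).
  rewrite pow_n_pow, <- RtoC_pow, re_scal_r; apply Rmult_comm.
- apply is_series_ext with (2 := is_series_Im _ _ H); intros n.
  change (Im (a n * RtoC t ^ n) = (pow_n t n * Im (a n))%R).
  rewrite pow_n_pow, <- RtoC_pow, im_scal_r; apply Rmult_comm.
Qed.

(** Multiplication by [Ci] keeps the modulus and moves the imaginary part, up to sign, to the real
    part. *)
Lemma Im_le_Cmod (c : C) : (Rabs (Im c) <= Cmod c)%R.
Proof.
replace (Im c) with (- Re (c * Ci))%R by (rewrite re_mult_Ci; ring).
rewrite Rabs_Ropp; apply Rle_trans with (1 := re_le_Cmod _).
rewrite Cmod_mult, Cmod_Ci; lra.
Qed.

Lemma CV_radius_everywhere (a : nat -> R) t :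
  (forall s, ex_pseries a s) -> Rbar_lt (Rabs t) (CV_radius a).
Proof.
intros H; apply Rbar_lt_le_trans with (Rabs (Rabs t + 1)).
- pose proof (Rabs_pos t); rewrite (Rabs_pos_eq (Rabs t + 1)) by lra.
  simpl; lra.
- apply ex_pseries_radius, H.
Qed.

Lemma is_derive_zero_eq (h : R -> R) :
  (forall t, is_derive h t 0%R) -> forall t, h t = h 0%R.
Proof.
intros H t; destruct (Rtotal_order t 0) as [Ht|[->|Ht]]; auto.
- apply (eq_is_derive h); auto.
- symmetry; apply (eq_is_derive h); auto.
Qed.

(** * Power series of the complex exponential along the real line *)

Section Exponential.

Variable z : C.

Let e (n : nat) : C := z ^ n / INR (fact n).
Let u := PSeries (fun n => Re (e n)).
Let v := PSeries (fun n => Im (e n)).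

Lemma e_S n : INR (S n) * e (S n) = z * e n.
Proof.
unfold e; rewrite fact_simpl, mult_INR, RtoC_mult, Cpow_S.
field; split; intros H; apply RtoC_inj in H;
  [exact (INR_fact_neq_0 n H)|exact (not_0_INR (S n) (Nat.neq_succ_0 n) H)].
Qed.

(** Comparison with the series of [exp (Cmod z * Rabs t)]. *)
Lemma ex_pseries_dominated (a : nat -> R) t :
  (forall n, (Rabs (a n) <= Cmod (e n))%R) -> ex_pseries a t.
Proof.
intros Ha.
apply (ex_series_le (K := R_AbsRing) (V := R_CompleteNormedModule) _
  (fun n => / INR (fact n) * (Cmod z * Rabs t) ^ n)%R).
- intros n; change (Rabs (pow_n t n * a n)
    <= / INR (fact n) * (Cmod z * Rabs t) ^ n)%R.
  rewrite pow_n_pow, Rabs_mult, <- RPow_abs, Rpow_mult_distr.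
  assert (He : Cmod (e n) = (Cmod z ^ n * / INR (fact n))%R).
  { unfold e; rewrite Cmod_div, Cmod_pow, Cmod_R, Rabs_pos_eq; auto.
    - apply pos_INR.
    - intros H; apply RtoC_inj in H; exact (INR_fact_neq_0 n H). }
  replace (/ INR (fact n) * (Cmod z ^ n * Rabs t ^ n))%R
    with (Rabs t ^ n * Cmod (e n))%R by (rewrite He; ring).
  apply Rmult_le_compat_l; [apply pow_le, Rabs_pos|apply Ha].
- exists (exp (Cmod z * Rabs t)).
  apply is_series_ext with (2 := is_exp_Reals (Cmod z * Rabs t)).
  intros n; rewrite pow_n_pow; apply Rmult_comm.
Qed.

Lemma ex_pseries_Re t : ex_pseries (fun n => Re (e n)) t.
Proof. apply ex_pseries_dominated; intros n; apply re_le_Cmod. Qed.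

Lemma ex_pseries_Im t : ex_pseries (fun n => Im (e n)) t.
Proof. apply ex_pseries_dominated; intros n; apply Im_le_Cmod. Qed.

(** By [e_S], differentiating term by term multiplies the coefficients [e] by [z]; this is the real
    part of [(u + i v)' = z (u + i v)]. *)
Lemma is_derive_u t : is_derive u t (Re z * u t - Im z * v t)%R.
Proof.
unfold u at 1; evar_last.
- apply is_derive_PSeries, CV_radius_everywhere, ex_pseries_Re.
- apply is_pseries_unique.
  apply is_series_ext with (2 := is_series_minus _ _ _ _
    (is_pseries_scal (Re z) _ t _ (Rmult_comm _ _)
      (PSeries_correct _ _ (ex_pseries_Re t)))
    (is_pseries_scal (Im z) _ t _ (Rmult_comm _ _)
      (PSeries_correct _ _ (ex_pseries_Im t)))).
  intros n; unfold PS_derive, PS_scal.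
  rewrite <- (re_scal_l (INR (S n))), e_S, re_mult.
  change (pow_n t n * (Re z * Re (e n)) - pow_n t n * (Im z * Im (e n)) =
    pow_n t n * (Re z * Re (e n) - Im z * Im (e n)))%R; ring.
Qed.

Lemma is_derive_v t : is_derive v t (Re z * v t + Im z * u t)%R.
Proof.
unfold v at 1; evar_last.
- apply is_derive_PSeries, CV_radius_everywhere, ex_pseries_Im.
- apply is_pseries_unique.
  apply is_series_ext with (2 := is_series_plus _ _ _ _
    (is_pseries_scal (Re z) _ t _ (Rmult_comm _ _)
      (PSeries_correct _ _ (ex_pseries_Im t)))
    (is_pseries_scal (Im z) _ t _ (Rmult_comm _ _)
      (PSeries_correct _ _ (ex_pseries_Re t)))).
  intros n; unfold PS_derive, PS_scal.
  rewrite <- (im_scal_l (INR (S n))), e_S, im_mult.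
  change (pow_n t n * (Re z * Im (e n)) + pow_n t n * (Im z * Re (e n)) =
    pow_n t n * (Re z * Im (e n) + Im z * Re (e n)))%R; ring.
Qed.

(* [exp(-z t) (u + i v)] has derivative 0 *)
Lemma u_v_Cexp (t : R) : Cexp (z * t) = (u t, v t).
Proof.
set (p := Re z); set (q := Im z).
assert (Hu : forall t, ex_derive u t)
  by (intros s; eexists; apply is_derive_u).
assert (Hv : forall t, ex_derive v t)
  by (intros s; eexists; apply is_derive_v).
assert (Du : forall t, Derive u t = (p * u t - q * v t)%R)
  by (intros s; apply is_derive_unique, is_derive_u).
assert (Dv : forall t, Derive v t = (p * v t + q * u t)%R)
  by (intros s; apply is_derive_unique, is_derive_v).
assert (u0 : u 0 = 1%R).
{ unfold u; rewrite PSeries_0; unfold e; simpl; field. }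
assert (v0 : v 0 = 0%R).
{ unfold v; rewrite PSeries_0; unfold e; simpl; field. }
(* [HX] and [HY] give the real and imaginary parts of [exp(-z t) (u + i v)], which is constant with
   value 1 at [t = 0]. *)
assert (HX : (exp (- (p * t)) * (u t * cos (q * t) + v t * sin (q * t)) = 1)%R).
{ rewrite (is_derive_zero_eq (fun t => exp (- (p * t)) *
    (u t * cos (q * t) + v t * sin (q * t)))%R).
  - rewrite u0, v0, !Rmult_0_r, Ropp_0, exp_0, cos_0; ring.
  - intros s; auto_derive; auto.
    change (fun x => u x) with u; change (fun x => v x) with v.
    rewrite Du, Dv; ring. }
assert (HY : (exp (- (p * t)) * (v t * cos (q * t) - u t * sin (q * t)) = 0)%R).
{ rewrite (is_derive_zero_eq (fun t => exp (- (p * t)) *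
    (v t * cos (q * t) - u t * sin (q * t)))%R).
  - rewrite u0, v0, !Rmult_0_r, sin_0; ring.
  - intros s; auto_derive; auto.
    change (fun x => u x) with u; change (fun x => v x) with v.
    rewrite Du, Dv; ring. }
assert (Hcs := sin2_cos2 (q * t)); unfold Rsqr in Hcs.
assert (Hexp : (exp (p * t) * exp (- (p * t)) = 1)%R)
  by (rewrite <- exp_plus, Rplus_opp_r; apply exp_0).
unfold Cexp; rewrite re_scal_r, im_scal_r; fold p q; f_equal.
(* The inserted 1 and 0 are replaced by the left sides of [HX] and [HY], which amounts to
   multiplying back by [exp(z t)]. *)
- transitivity (exp (p * t) * (1 * cos (q * t) - 0 * sin (q * t)))%R; [ring|].
  rewrite <- HX at 1; rewrite <- HY at 1.
  transitivity ((exp (p * t) * exp (- (p * t))) * u t *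
    (sin (q * t) * sin (q * t) + cos (q * t) * cos (q * t)))%R; [ring|].
  rewrite Hexp, Hcs; ring.
- transitivity (exp (p * t) * (1 * sin (q * t) + 0 * cos (q * t)))%R; [ring|].
  rewrite <- HX at 1; rewrite <- HY at 1.
  transitivity ((exp (p * t) * exp (- (p * t))) * v t *
    (sin (q * t) * sin (q * t) + cos (q * t) * cos (q * t)))%R; [ring|].
  rewrite Hexp, Hcs; ring.
Qed.

Lemma cgerm_Cexp :
  cgerm (fun n => z ^ n / INR (fact n)) (fun t => Cexp (z * t)).
Proof.
split; unfold rgerm; apply filter_forall; intros t; rewrite u_v_Cexp;
  apply PSeries_correct; [apply ex_pseries_Re|apply ex_pseries_Im].
Qed.

End Exponential.

(** * The generating function *)

Lemma RtoC_neq_0 (r : R) : r <> 0%R -> RtoC r <> 0.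
Proof. intros H E; apply H, RtoC_inj, E. Qed.

Lemma cgerm_sum_n_m (a : nat -> nat -> C) (F : nat -> R -> C) m :
  (forall i, cgerm (a i) (F i)) ->
  cgerm (fun n => sum_n_m (fun i => a i n) 1 m)
        (fun t => sum_n_m (fun i => F i t) 1 m).
Proof.
intros H; induction m as [|m IH].
- apply cgerm_ext with (fun _ => RtoC 0) (fun _ => RtoC 0).
  + intros n; rewrite sum_n_m_zero by lia; reflexivity.
  + apply filter_forall; intros t; rewrite sum_n_m_zero by lia; reflexivity.
  + exact (cgerm_real _ _ rgerm_0).
- apply cgerm_ext with (3 := cgerm_plus _ _ _ _ IH (H (S m))).
  + intros n; rewrite sum_n_Sm by lia; reflexivity.
  + apply filter_forall; intros t; rewrite sum_n_Sm by lia; reflexivity.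
Qed.

Lemma sum_n_m_scal_C (c : C) (a : nat -> C) n m :
  sum_n_m (fun k => c * a k) n m = c * sum_n_m a n m.
Proof. exact (sum_n_m_mult_l c a n m). Qed.

(** * The exponential tail, the coefficient equation and its solution *)

Section ExpTail.

Variables (N f : nat).
Hypothesis N_pos : (1 <= N)%nat.
Hypothesis f_pos : (1 <= f)%nat.

(* [sum_i w^i / (N+i)!], so that [exp_tail N f t = (f t)^N tail_quot (f t)] *)
Definition tail_quot (w : R) : R :=
  PSeries (fun i => / INR (fact (N + i)))%R w.

(** These are the coefficients of [exp] shifted by [N]. *)
Lemma ex_pseries_tail_quot w : ex_pseries (fun i => / INR (fact (N + i)))%R w.
Proof.
apply (ex_pseries_decr_n (fun i => / INR (fact i))%R N w).
- destruct (Req_dec w 0) as [->|Hw]; [left; reflexivity|right].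
  exists (/ w)%R; apply Rinv_l, Hw.
- exists (exp w); apply is_exp_Reals.
Qed.

Lemma exp_tail_quot (t : R) :
  exp_tail N f t = RtoC ((INR f * t) ^ N * tail_quot (INR f * t)).
Proof.
unfold exp_tail; set (w := (INR f * t)%R).
replace (INR f * t) with (RtoC w) by apply RtoC_mult.
assert (Hw : Cexp w = RtoC (exp w)).
{ unfold Cexp, RtoC; simpl; rewrite cos_0, sin_0; f_equal; ring. }
rewrite Hw.
rewrite (sum_n_ext_C _ (fun m => RtoC (/ INR (fact m) * w ^ m))).
2: { intros k _; rewrite RtoC_mult, RtoC_pow, RtoC_inv by apply INR_fact_neq_0.
     unfold Cdiv; apply Cmult_comm. }
rewrite <- RtoC_sum_n, <- RtoC_minus, sum_n_Reals; f_equal.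
replace (exp w) with (PSeries (fun n => / INR (fact n))%R w)
  by apply is_pseries_unique, is_exp_Reals.
(* The sum up to index [N - 1] is exactly the first [N] terms of [exp w]; the rest is [w^N] times
   the series of [tail_quot]. *)
rewrite (PSeries_decr_n _ (N - 1) w) by (exists (exp w); apply is_exp_Reals).
replace (S (N - 1)) with N by lia.
unfold tail_quot, PS_decr_n; ring.
Qed.

Lemma rgerm_tail_quot :
  rgerm (fun i => / INR (fact (N + i)) * INR f ^ i)%R
        (fun t => tail_quot (INR f * t)).
Proof.
unfold rgerm; apply filter_forall; intros t.
apply is_series_ext with
  (2 := PSeries_correct _ _ (ex_pseries_tail_quot (INR f * t)%R)).
intros i; rewrite !pow_n_pow.
change ((INR f * t) ^ i * / INR (fact (N + i)) =
  t ^ i * (/ INR (fact (N + i)) * INR f ^ i))%R.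
rewrite Rpow_mult_distr; ring.
Qed.

(** By continuity, since the value at 0 is [1/N!]. This permits clearing the denominator near 0. *)
Lemma tail_quot_neq_0 :
  locally 0%R (fun t => tail_quot (INR f * t) <> 0%R).
Proof.
apply (locally_pt_comp (fun y => y <> 0%R)
  (fun t => tail_quot (INR f * t)) 0%R).
- rewrite Rmult_0_r; unfold tail_quot; rewrite PSeries_0.
  apply open_neq, Rinv_neq_0_compat, INR_fact_neq_0.
- apply (continuity_pt_comp (fun t => INR f * t)%R tail_quot).
  + apply continuity_pt_mult; [apply continuity_pt_const|apply continuity_pt_id].
    intros ? ?; reflexivity.
  + apply PSeries_continuity, CV_radius_everywhere, ex_pseries_tail_quot.
Qed.

Variable chi : Z -> C.

(** The prefactor is [f^N g(f t)], because [g = N! tail_quot]; the powers [t^N] cancel. *)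
Lemma gen_fun_poly_tail_quot (x : C) (t : R) : t <> 0%R ->
  tail_quot (INR f * t) <> 0%R ->
  RtoC (INR f ^ N * INR (fact N) * tail_quot (INR f * t)) *
    gen_fun_poly N f chi x t =
  sum_n_m (fun a : nat => chi (Z.of_nat a) * Cexp ((x + INR a) * t)) 1 f.
Proof.
intros Ht Hq; unfold gen_fun_poly; rewrite <- sum_n_m_scal_C.
apply sum_n_m_ext; intros a.
rewrite exp_tail_quot, Rpow_mult_distr, !RtoC_mult, !RtoC_pow.
assert (Hf : INR f <> 0%R) by (apply not_0_INR; lia).
match goal with |- @eq _ ?l ?r => change (@eq C l r) end.
field; repeat split; try apply Cpow_nz; apply RtoC_neq_0; auto.
apply INR_fact_neq_0.
Qed.

(** The removable singularity is filled with [B O], the value of the power series at 0. *)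
Lemma cgerm_gen_fun_poly (x : C) (B : nat -> C) :
  (forall t : C, t <> RtoC 0 -> (Cmod t < 2 * PI / INR f)%R ->
     is_series (fun n : nat => B n * (t ^ n / INR (fact n)))
               (gen_fun_poly N f chi x t)) ->
  cgerm (fun n => B n / INR (fact n))
    (fun t => if Req_EM_T t 0 then B O else gen_fun_poly N f chi x t).
Proof.
intros HB; apply cgerm_intro.
assert (Hr : (0 < 2 * PI / INR f)%R).
{ apply Rdiv_lt_0_compat; [pose proof PI_RGT_0; lra|apply lt_0_INR; lia]. }
exists (mkposreal _ Hr); intros t Ht.
change (Rabs (t - 0) < 2 * PI / INR f)%R in Ht; rewrite Rminus_0_r in Ht.
destruct (Req_EM_T t 0) as [->|H0].
- assert (H := is_pseries_0 (V := C_NormedModule) (fun n => B n / INR (fact n))).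
  cbv beta in H; replace (B O / INR (fact 0)) with (B O) in H by (simpl; field).
  apply is_series_ext with (2 := H); intros n.
  change (pow_n (K := C_Ring) (RtoC 0) n * (B n / INR (fact n)) =
    B n / INR (fact n) * RtoC 0 ^ n).
  destruct n as [|n]; simpl; [change (@one C_Ring) with (RtoC 1)|
    change (@mult C_Ring) with Cmult]; ring.
- apply is_series_ext with (2 := HB t (RtoC_neq_0 _ H0)
    (eq_ind_r (fun r => r < _)%R Ht (Cmod_R t))).
  intros n; unfold Cdiv; change (B n * (RtoC t ^ n * / INR (fact n)) =
    B n * / INR (fact n) * RtoC t ^ n); ring.
Qed.

Lemma conv_gen_fun_poly (x : C) (B : nat -> C) n :
  (forall t : C, t <> RtoC 0 -> (Cmod t < 2 * PI / INR f)%R ->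
     is_series (fun n : nat => B n * (t ^ n / INR (fact n)))
               (gen_fun_poly N f chi x t)) ->
  conv (fun i => RtoC (INR f ^ N * INR (fact N) *
                        (/ INR (fact (N + i)) * INR f ^ i)))
       (fun n => B n / INR (fact n)) n =
  S_chi_poly f chi n x / INR (fact n).
Proof.
intros HB.
assert (HL := cgerm_shift _ _ (cgerm_mult _ _ _ _
  (cgerm_real _ _ (rgerm_scal (INR f ^ N * INR (fact N))%R _ _ rgerm_tail_quot))
  (cgerm_gen_fun_poly x B HB))).
assert (HR := cgerm_shift _ _ (cgerm_sum_n_m
  (fun a n => chi (Z.of_nat a) * ((x + INR a) ^ n / INR (fact n)))
  (fun a t => chi (Z.of_nat a) * Cexp ((x + INR a) * t)) f
  (fun a => cgerm_scal _ _ _ (cgerm_Cexp (x + INR a))))).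
(* Both sides carry an extra factor [t], so degree [n] of the original identity sits at index
   [S n]. *)
etransitivity; [refine (cgerm_unique _ _ _ HL
  (cgerm_ext _ _ _ _ (fun k => eq_refl) _ HR) (S n))|].
- generalize tail_quot_neq_0; apply filter_imp; intros t Hq; cbv beta.
  destruct (Req_EM_T t 0) as [->|Ht]; [ring|].
  rewrite gen_fun_poly_tail_quot; auto.
- simpl; unfold S_chi_poly, Cdiv; rewrite Cmult_comm, <- sum_n_m_scal_C.
  apply sum_n_m_ext; intros a.
  match goal with |- @eq _ ?l ?r => change (@eq C l r) end; ring.
Qed.

(** With [x] and the sequence [B] fixed, this covers the polynomials directly and the numbers
    through [x = 0]. *)
Lemma explicit_formula (x : C) (B : nat -> C) n :
  (forall t : C, t <> RtoC 0 -> (Cmod t < 2 * PI / INR f)%R ->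
     is_series (fun n : nat => B n * (t ^ n / INR (fact n)))
               (gen_fun_poly N f chi x t)) ->
  B n = sum_n (fun k : nat =>
          explicit_coef N f n k * S_chi_poly f chi (n - k) x) n.
Proof.
intros HB.
assert (Hf : INR f <> 0%R) by (apply not_0_INR; lia).
(* [G], [c0] and [c] hold the coefficients of [f^N g(f t)], of [1/g(t)] and of [1/(f^N g(f t))]. *)
set (G := fun i => RtoC (INR f ^ N * INR (fact N) *
                        (/ INR (fact (N + i)) * INR f ^ i))).
set (c0 := fun k => sum_n (fun r : nat =>
  Binomial.C (k + 1) (r + 1) * T_tilde N r k)%R k).
set (c := fun k => RtoC (INR f ^ k / INR f ^ N * c0 k)).
set (b := fun n => B n / INR (fact n)).
assert (Hc0 : forall k, conv (tail_coef N) (fun k => RtoC (c0 k)) k = conv_one k).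
{ intros k; rewrite <- (conv_reciprocal (tail_coef N)
    (fun r k => RtoC (T_tilde N r k))).
  - apply conv_ext; auto; intros j _; unfold c0; rewrite RtoC_sum_n.
    apply sum_n_ext_C; intros; apply RtoC_mult.
  - unfold tail_coef; rewrite Nat.add_0_r; f_equal.
    apply Rinv_r, INR_fact_neq_0.
  - intros [|j]; simpl; [rewrite T_tilde_0_0|rewrite T_tilde_0_S]; auto.
  - intros; apply T_tilde_S. }
assert (Hc : forall k, conv c G k = conv_one k).
{ intros k; rewrite conv_comm.
  (* Substituting [f t] for [t] scales degree [k] by [f^k], which leaves the series 1 unchanged. *)
  transitivity (INR f ^ k * conv_one k).
  - rewrite <- Hc0; unfold conv; rewrite <- sum_n_scal_C.
    apply sum_n_ext_C; intros j Hj; unfold G, c, tail_coef.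
    rewrite <- RtoC_pow, <- !RtoC_mult; f_equal.
    replace (INR f ^ k)%R with (INR f ^ j * INR f ^ (k - j))%R
      by (rewrite <- pow_add; f_equal; lia).
    field; split; [apply INR_fact_neq_0|apply pow_nonzero, Hf].
  - destruct k; simpl; ring. }
(* Associativity solves the equation: [b = (c G) b = c (G b)]. *)
assert (Hb : b n = conv c (fun n => S_chi_poly f chi n x / INR (fact n)) n).
{ rewrite <- (conv_one_l b).
  rewrite (conv_ext _ (conv c G) _ b) by (intros; rewrite ?Hc; auto).
  rewrite conv_assoc; apply conv_ext; auto.
  intros k _; apply conv_gen_fun_poly, HB. }
assert (Hn : forall k, RtoC (INR (fact k)) <> 0)
  by (intros k; apply RtoC_neq_0, INR_fact_neq_0).
replace (B n) with (INR (fact n) * b n) by (unfold b; field; auto).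
rewrite Hb; unfold conv; rewrite <- sum_n_scal_C.
apply sum_n_ext_C; intros k Hk; unfold explicit_coef, c; fold (c0 k).
assert (Hp : powerRZ (INR f) (Z.of_nat N - Z.of_nat k) =
  (INR f ^ N / INR f ^ k)%R).
{ unfold Zminus; rewrite powerRZ_add, powerRZ_neg', <- !pow_powerRZ; auto. }
rewrite Hp; unfold Binomial.C.
(* Here [k! binom(n, k) = n!/(n-k)!]. *)
replace (INR (fact k) / (INR f ^ N / INR f ^ k) *
  (INR (fact n) / (INR (fact k) * INR (fact (n - k)))) * c0 k)%R
  with (INR (fact n) * (INR f ^ k / INR f ^ N * c0 k) / INR (fact (n - k)))%R.
- rewrite RtoC_div, (RtoC_mult (INR (fact n))).
  + field; auto.
  + apply INR_fact_neq_0.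
- field; repeat split; try apply INR_fact_neq_0; apply pow_nonzero, Hf.
Qed.

End ExpTail.

Local Close Scope C_scope.

Theorem theorem5p2 (N : nat) (hN : (1 <= N)%nat)
    (m f : nat) (chi : Z -> C)
    (hchi : dirichlet_character m chi) (hf : has_conductor m chi f)
    (B : nat -> C) (hB : hyp_bernoulli_numbers N f chi B)
    (Bp : nat -> C -> C) (hBp : hyp_bernoulli_polys N f chi Bp)
    (n : nat) (hn : (1 <= n)%nat) :
  B n = sum_n (fun k : nat =>
          explicit_coef N f n k * S_chi f chi (n - k))%C n
  /\
  forall x : C,
    Bp n x = sum_n (fun k : nat =>
               explicit_coef N f n k * S_chi_poly f chi (n - k) x)%C n.
Proof.
assert (Hf : (1 <= f)%nat).
(* The conductor divides the positive modulus [m], so it is not 0. *)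
{ destruct hf as [[[q Hq] _] _]; pose proof (dirichlet_modulus_pos _ _ hchi).
  destruct f; lia. }
split.
- rewrite (explicit_formula N f hN Hf chi 0 B).
  + apply sum_n_ext_C; intros k _; do 2 f_equal.
    apply sum_n_m_ext; intros a; rewrite Cplus_0_l; reflexivity.
  + intros t H0 Ht; replace (gen_fun_poly N f chi 0 t) with (gen_fun N f chi t).
    * exact (hB t H0 Ht).
    * apply sum_n_m_ext; intros a; rewrite Cplus_0_l; reflexivity.
- intros x; apply (explicit_formula N f hN Hf chi x (fun n => Bp n x)).
  exact (hBp x).
Qed.
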